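(* Let $N, M \geq 1$ be integers, let $\Delta t > 0$, and let $c, \beta, \gamma \geq 0$ and $J$, $\mathfrak{m}^2$ be real numbers. Let $(u_n^k)$, $0 \leq n \leq N+1$, $0 \leq k \leq M+1$, be real numbers satisfying the following finite-difference scheme: for all $1 \leq n \leq N$ and $1 \leq k \leq M$, $$\frac{\delta_t^2 u_n^k}{(\Delta t)^2} - \left( \frac{c^2}{4} \delta^2 + \frac{\beta}{2 \Delta t} \delta_t \right) \delta_x^2 u_n^k + \frac{\gamma}{2 \Delta t} \delta_t u_n^k + \frac{\mathfrak{m}^2}{2} \bar{\delta} u_n^k + \frac{V(u_n^{k+1}) - V(u_n^{k-1})}{u_n^{k+1} - u_n^{k-1}} - J = 0,$$ subject to $$u_n^0 = 0, \quad u_n^1 = 0 \quad (1 \leq n \leq N),$$ $$c^2 \bar{\delta}(u_0^k - u_1^k) + \frac{\beta\, \delta_t (u_0^k - u_1^k)}{\Delta t} = 2 \phi_k \quad (1 \leq k \leq M),$$ $$u_{N+1}^k - u_N^k = 0 \quad (0 \leq k \leq M+1).$$ For $0 \leq k \leq M$ define $$\begin{aligned} H_n^k = {}& \frac{1}{2} \left( \frac{u_n^{k+1} - u_n^k}{\Delta t} \right)^2 + \frac{c^2}{4} \left[ \left( \frac{u_{n+1}^{k+1} + u_{n+1}^k}{2} - \frac{u_n^{k+1} + u_n^k}{2} \right)^2 + \left( \frac{u_{n-1}^{k+1} + u_{n-1}^k}{2} - \frac{u_n^{k+1} + u_n^k}{2} \right)^2 \right] \\ & + \frac{\mathfrak{m}^2}{2}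 \cdot \frac{(u_n^{k+1})^2 + (u_n^k)^2}{2} + \frac{V(u_n^{k+1}) + V(u_n^k)}{2} - J\, \frac{u_n^{k+1} + u_n^k}{2} \qquad (1 \leq n \leq N), \end{aligned}$$ $$E_k = \sum_{n=1}^N H_n^k + \frac{c^2}{4} \left( \frac{u_1^{k+1} + u_1^k}{2} - \frac{u_0^{k+1} + u_0^k}{2} \right)^2.$$ Then, for every $1 \leq k \leq M$, $$\begin{aligned} \frac{E_k - E_{k-1}}{\Delta t} = {}& - \beta \left\{ \sum_{n=1}^N \left( \frac{\delta_t u_n^k - \delta_t u_{n-1}^k}{2 \Delta t} \right)^2 + \left( \frac{\delta_t u_1^k - \delta_t u_0^k}{2 \Delta t} \right) \frac{\delta_t u_0^k}{2 \Delta t} \right\} \\ & - \gamma \sum_{n=1}^N \left( \frac{\delta_t u_n^k}{2 \Delta t} \right)^2 + c^2 \left[ \left( \frac{\delta^2 u_0^k - \delta^2 u_1^k}{4} \right) \frac{\delta_t u_0^k}{2 \Delta t} \right]. \end{aligned}$$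
   Context: The potential is $V(u) = 1 - \cos u$. The difference operators are $$\delta_t u_n^k = u_n^{k+1} - u_n^{k-1}, \quad \delta_t^2 u_n^k = u_n^{k+1} - 2 u_n^k + u_n^{k-1}, \quad \delta_x^2 u_n^k = u_{n+1}^k - 2 u_n^k + u_{n-1}^k,$$ $$\bar{\delta} u_n^k = u_n^{k+1} + u_n^{k-1}, \quad \delta^2 u_n^k = u_n^{k+1} + 2 u_n^k + u_n^{k-1},$$ and operators in the time index and in the space index are composed, so for example $\delta^2 \delta_x^2 u_n^k = \delta_x^2 u_n^{k+1} + 2 \delta_x^2 u_n^k + \delta_x^2 u_n^{k-1}$ and $\delta_t \delta_x^2 u_n^k = \delta_x^2 u_n^{k+1} - \delta_x^2 u_n^{k-1}$. Note that $\delta_t$ does not include division by the time step. The numbers $\phi_k = \phi(k \Delta t)$ are the values of the driving function $\phi(t) = A \sin(\Omega t)$, with $A$, $\Omega$ real constants. The constant $\mathfrak{m}$ is a real or pure-imaginary number, so $\mathfrak{m}^2$ is real. The quotient $\frac{V(u_n^{k+1}) - V(u_n^{k-1})}{u_n^{k+1} - u_n^{k-1}}$ is understood as $V'(u_n^{k-1})$ when $u_n^{k+1} = u_n^{k-1}$. *)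

(* Defs.v *)
From mathcomp Require Import all_boot all_order all_algebra.
From mathcomp Require Import all_classical all_reals all_analysis.
Import Order.TTheory GRing.Theory Num.Theory.
Import numFieldNormedType.Exports.

Set Implicit Arguments.
Unset Strict Implicit.
Unset Printing Implicit Defensive.

Local Open Scope ring_scope.

(* A grid function is [u : nat -> nat -> R], where [u n k] is u_n^k: the space
   index comes first, so that [u n] is the time sequence at site [n].  Indices
   are natural numbers and [0.-1 = 0], so the operators below have their usual
   meaning only at indices at least 1. *)

Section TimeOperators.
Variable R : realType.
Implicit Types (v : nat -> R) (k : nat).

Definition delta_t v k : R := v k.+1 - v k.-1.

Definition delta_t2 v k : R := v k.+1 - 2 * v k + v k.-1.

Definition delta_bar v k : R := v k.+1 + v k.-1.

Definition delta_sq v k : R := v k.+1 + 2 * v k + v k.-1.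

End TimeOperators.

Definition delta_x2 (R : realType) (u : nat -> nat -> R) (n k : nat) : R :=
  u n.+1 k - 2 * u n k + u n.-1 k.

Definition V (R : realType) (x : R) : R := 1 - cos x.

(* The difference quotient of [V], completed by V'(b) when a = b. *)
Definition V_quotient (R : realType) (a b : R) : R :=
  if a == b then (@V R)^`()%classic b else (V a - V b) / (a - b).

Definition phi (R : realType) (A Omega t : R) : R := A * sin (Omega * t).

(* [m2] stands for the square of the mass constant, which may be negative. *)
Definition scheme_lhs (R : realType) (dt c beta gamma J m2 : R)
    (u : nat -> nat -> R) (n k : nat) : R :=
  delta_t2 (u n) k / dt ^+ 2
  - (c ^+ 2 / 4 * delta_sq (delta_x2 u n) k
     + beta / (2 * dt) * delta_t (delta_x2 u n) k)
  + gamma / (2 * dt) * delta_t (u n) k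
  + m2 / 2 * delta_bar (u n) k
  + V_quotient (u n k.+1) (u n k.-1)
  - J.

Definition H (R : realType) (dt c J m2 : R)
    (u : nat -> nat -> R) (n k : nat) : R :=
  1 / 2 * ((u n k.+1 - u n k) / dt) ^+ 2
  + c ^+ 2 / 4 *
    (((u n.+1 k.+1 + u n.+1 k) / 2 - (u n k.+1 + u n k) / 2) ^+ 2
     + ((u n.-1 k.+1 + u n.-1 k) / 2 - (u n k.+1 + u n k) / 2) ^+ 2)
  + m2 / 2 * ((u n k.+1 ^+ 2 + u n k ^+ 2) / 2)
  + (V (u n k.+1) + V (u n k)) / 2
  - J * ((u n k.+1 + u n k) / 2).

Definition E (R : realType) (N : nat) (dt c J m2 : R)
    (u : nat -> nat -> R) (k : nat) : R :=
  \sum_(1 <= n < N.+1) H dt c J m2 u n k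
  + c ^+ 2 / 4 *
    ((u 1%N k.+1 + u 1%N k) / 2 - (u 0%N k.+1 + u 0%N k) / 2) ^+ 2.

(* Main.v *)
(* Multiply the scheme at site n by the discrete velocity delta_t u_n / (2 dt)
   and sum over n.  The kinetic, mass, potential and forcing terms become time
   differences of the corresponding parts of H_n.  The coupling terms leave the
   beta dissipation plus a spatial difference G_(n+1) - G_n of an energy flux;
   G_(N+1) = 0 by the free-end condition, while G_1 combines with the extra
   boundary term in E_k into the inflow at site 0. *)
Require Import Defs.
From mathcomp Require Import all_boot all_order all_algebra.
From mathcomp Require Import all_classical all_reals all_analysis.
From mathcomp Require Import ring.
Import Order.TTheory GRing.Theory Num.Theory.
Import numFieldNormedType.Exports.
Local Open Scope ring_scope.

(** At [a = b] both sides vanish, so the derivative is never computed. *)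
Lemma V_quotientM {R : realType} (a b : R) :
  V_quotient a b * (a - b) = V a - V b.
Proof.
rewrite /V_quotient; case: eqVneq => [->|neq_ab]; first by rewrite !subrr mulr0.
by rewrite divfK // subr_eq0.
Qed.

(** Each site owns half of its two bonds, so the elastic part uses the mean velocity across the
    bond; the [beta] part uses only the left velocity, so that summation by parts leaves an exact
    square. *)
Definition energy_flux {R : realType} (dt c beta : R) (u : nat -> nat -> R)
    (k n : nat) : R :=
  c ^+ 2 / (16 * dt) * (delta_sq (u n) k - delta_sq (u n.-1) k)
    * (delta_t (u n) k + delta_t (u n.-1) k)
  + beta / (4 * dt ^+ 2) * (delta_t (u n) k - delta_t (u n.-1) k)
    * delta_t (u n.-1) k.

Lemma local_energy_balance {R : realType} {dt : R} (c beta gamma J m2 : R)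
    (u : nat -> nat -> R) {n k : nat} :
  dt != 0 -> (0 < n)%N -> (0 < k)%N ->
  (H dt c J m2 u n k - H dt c J m2 u n k.-1) / dt =
    scheme_lhs dt c beta gamma J m2 u n k * (delta_t (u n) k / (2 * dt))
    - beta * ((delta_t (u n) k - delta_t (u n.-1) k) / (2 * dt)) ^+ 2
    - gamma * (delta_t (u n) k / (2 * dt)) ^+ 2
    + (energy_flux dt c beta u k n.+1 - energy_flux dt c beta u k n).
Proof.
move=> dt0; case: n => // n _; case: k => // k _.
(* With [V_quotient] kept opaque, this substitution turns the balance into a rational identity. *)
have VE : V (u n.+1 k.+2) =
    V (u n.+1 k) + V_quotient (u n.+1 k.+2) (u n.+1 k)
                   * (u n.+1 k.+2 - u n.+1 k).
  by rewrite V_quotientM addrC subrK.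
rewrite /H /scheme_lhs /energy_flux /delta_x2 /delta_t /delta_t2 /delta_bar
  /delta_sq /= VE.
by field.
Qed.

Theorem proposition4 (R : realType) (N M : nat)
    (dt c beta gamma J m2 A Omega : R) (u : nat -> nat -> R)
    (hN : (1 <= N)%N) (hM : (1 <= M)%N) (hdt : 0 < dt)
    (hc : 0 <= c) (hbeta : 0 <= beta) (hgamma : 0 <= gamma)
    (hscheme : forall n k : nat, (1 <= n <= N)%N -> (1 <= k <= M)%N ->
       scheme_lhs dt c beta gamma J m2 u n k = 0)
    (hinit : forall n : nat, (1 <= n <= N)%N ->
       u n 0%N = 0 /\ u n 1%N = 0)
    (hleft : forall k : nat, (1 <= k <= M)%N ->
       c ^+ 2 * delta_bar (fun j => u 0%N j - u 1%N j) k
       + beta * delta_t (fun j => u 0%N j - u 1%N j) k / dt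
       = 2 * phi A Omega (k%:R * dt))
    (hright : forall k : nat, (k <= M.+1)%N -> u N.+1 k - u N k = 0) :
  forall k : nat, (1 <= k <= M)%N ->
    (E N dt c J m2 u k - E N dt c J m2 u k.-1) / dt =
      - beta *
        (\sum_(1 <= n < N.+1)
            ((delta_t (u n) k - delta_t (u n.-1) k) / (2 * dt)) ^+ 2
         + (delta_t (u 1%N) k - delta_t (u 0%N) k) / (2 * dt)
           * (delta_t (u 0%N) k / (2 * dt)))
      - gamma * (\sum_(1 <= n < N.+1) (delta_t (u n) k / (2 * dt)) ^+ 2)
      + c ^+ 2 *
        ((delta_sq (u 0%N) k - delta_sq (u 1%N) k) / 4
         * (delta_t (u 0%N) k / (2 * dt))).
Proof.
move=> k /andP[k_gt0 k_leM].
have dt0 : dt != 0 by rewrite gt_eqF.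
have site n : (1 <= n < N.+1)%N -> H dt c J m2 u n k - H dt c J m2 u n k.-1 =
    dt * (- beta * ((delta_t (u n) k - delta_t (u n.-1) k) / (2 * dt)) ^+ 2
    - gamma * (delta_t (u n) k / (2 * dt)) ^+ 2
    + (energy_flux dt c beta u k n.+1 - energy_flux dt c beta u k n)).
  move=> nN; have n_gt0 : (0 < n)%N by case/andP: nN.
  have := local_energy_balance c beta gamma J m2 u dt0 n_gt0 k_gt0.
  rewrite hscheme ?k_gt0 // mul0r add0r mulNr => <-.
  by rewrite mulrC divfK.
(* Both flux terms contain a difference across the last bond, at times up to [k.+1], hence within
   [M.+1]. *)
have fluxN : energy_flux dt c beta u k N.+1 = 0.
  have uN j : (j <= M.+1)%N -> u N.+1 j = u N j by move/hright/subr0_eq.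
  rewrite /energy_flux /delta_sq /delta_t /= !uN ?subrr ?mulr0 ?mul0r ?addr0 //.
    exact: leq_trans (leq_pred k) (leqW k_leM).
  exact: leqW.
set S1 := \sum_(1 <= n < N.+1) (_ / _) ^+ 2.
set S2 := \sum_(1 <= n < N.+1) (_ / _) ^+ 2.
have sumH : \sum_(1 <= n < N.+1) H dt c J m2 u n k
    - \sum_(1 <= n < N.+1) H dt c J m2 u n k.-1
    = dt * (- beta * S1 - gamma * S2 - energy_flux dt c beta u k 1).
  rewrite -sumrB (eq_big_nat _ _ site) -mulr_sumr big_split /= sumrB.
  by rewrite -!mulr_sumr telescope_sumr // fluxN sub0r.
rewrite /E opprD addrACA sumH /energy_flux {sumH}.
(* Only the bond between sites 0 and 1 remains. Writing v for [delta_t], the elastic terms combine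
   as (v_1 - v_0) - (v_1 + v_0) = -2 v_0, which leaves the work done at site 0. *)
move: S1 S2; case: k k_gt0 {k_leM site fluxN} => // k _ S1 S2.
rewrite /delta_sq /delta_t /=.
by field.
Qed.
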